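(* Let $\Gamma$ be a finite connected metric graph. A finite set $\{\varphi_1,\dots,\varphi_n\}\subset \mathrm{PL}(\Gamma)$ is tropically independent if and only if there are real numbers $b_1,\dots,b_n$ such that, for each $i$, the function $\varphi_i+b_i$ achieves the minimum in $\min_j\{\varphi_j+b_j\}$ uniquely at some point $v_i\in\Gamma$.
   Context: $\mathrm{PL}(\Gamma)$ is the set of continuous piecewise linear functions $\Gamma\to\mathbb R$ with integer slopes. A finite collection $\{\psi_1,\dots,\psi_n\}$ of real-valued functions on $\Gamma$ is tropically dependent if there are real numbers $b_1,\dots,b_n$ such that for every $v\in\Gamma$ the minimum $\min_i\{\psi_i(v)+b_i\}$ is achieved for at least two distinct indices $i$; otherwise it is tropically independent. Given $\theta=\min_j\{\varphi_j+b_j\}$, the function $\varphi_i+b_i$ achieves the minimum uniquely at $v$ if $\theta(v)=\varphi_i(v)+b_i$ and $\theta(v)\ne\varphi_j(v)+b_j$ for all $j\neq i$. *)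

(* Defs.v *)
From HB Require Import structures.
From mathcomp Require Import all_boot all_order all_algebra.
From mathcomp Require Import all_classical all_reals all_analysis.
Set Implicit Arguments.
Unset Strict Implicit.
Unset Printing Implicit Defensive.
Import Order.TTheory GRing.Theory Num.Theory.
Import numFieldNormedType.Exports.
Local Open Scope classical_set_scope.
Local Open Scope ring_scope.

(* Loops and parallel edges are allowed.  The orientation of an edge is only
   used to parametrize it by arc length. *)
Record metric_graph (R : realType) := MetricGraph {
  vertex : finType;
  edge : finType;
  src : edge -> vertex;
  tgt : edge -> vertex;
  len : edge -> R;
  len_gt0 : forall e, 0 < len e
}.

(* The points of the metric graph: the quotient of the disjoint union of the
   vertices and of the segments [0, len e] that glues 0 to [src e] and
   [len e] to [tgt e], in normal form. *)
Inductive graph_point (R : realType) (G : metric_graph R) : Type :=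
| Vertex of vertex G
| Interior (e : edge G) (t : R) of 0 < t < len e.

(* The arc-length parametrization of the closed edge [e] by [0, len e],
   extended to R by constants. *)
Definition edge_pt (R : realType) (G : metric_graph R) (e : edge G) (t : R) :
    graph_point G :=
  match boolP (0 < t < len e) with
  | AltTrue h => Interior h
  | AltFalse _ => if t <= 0 then Vertex (src e) else Vertex (tgt e)
  end.

(* The quotient topology.  Since [edge_pt e] factors through the retraction of
   R onto [0, len e], the preimage of [U] is open in R if and only if its trace
   on [0, len e] is relatively open.  On a connected graph this is the topology
   of the path metric. *)
Definition graph_open (R : realType) (G : metric_graph R) : set_system (graph_point G) :=
  [set U | forall e : edge G, open (edge_pt e @^-1` U)].

Lemma graph_openT (R : realType) (G : metric_graph R) :
  @graph_open R G setT.
Proof. by move=> e; rewrite preimage_setT; exact: openT. Qed.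

Lemma graph_openI (R : realType) (G : metric_graph R) :
  setI_closed (@graph_open R G).
Proof. by move=> A B oA oB e; rewrite preimage_setI; exact: openI. Qed.

Lemma graph_open_bigU (R : realType) (G : metric_graph R)
    (I : Type) (F : I -> set (graph_point G)) :
  (forall i, graph_open (F i)) -> graph_open (\bigcup_i F i).
Proof.
by move=> oF e; rewrite preimage_bigcup; apply: bigcup_open => i _; exact: oF.
Qed.

HB.instance Definition _ (R : realType) (G : metric_graph R) :=
  gen_eqMixin (graph_point G).
HB.instance Definition _ (R : realType) (G : metric_graph R) :=
  gen_choiceMixin (graph_point G).
HB.instance Definition _ (R : realType) (G : metric_graph R) :=
  isOpenTopological.Build (graph_point G)
    (@graph_openT R G) (@graph_openI R G) (@graph_open_bigU R G).

Lemma graph_openE (R : realType) (G : metric_graph R) (U : set (graph_point G)) :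
  open U = graph_open U.
Proof. by []. Qed.

(* [connected] holds of the empty set, but a connected graph is nonempty. *)
Definition connected_graph (R : realType) (G : metric_graph R) : Prop :=
  [set: graph_point G] !=set0 /\ connected [set: graph_point G].

Definition piecewise_linear_int (R : realType) (a b : R) (f : R -> R) : Prop :=
  exists2 s : seq R, itv_partition a b s &
    forall k, (k < size s)%N ->
      exists (m : int) (c : R), forall t : R,
        nth 0 (a :: s) k <= t <= nth 0 s k -> f t = m%:~R * t + c.

Definition PL (R : realType) (G : metric_graph R) : set (graph_point G -> R) :=
  [set f | continuous f /\
    forall e : edge G, piecewise_linear_int 0 (len e) (f \o edge_pt e)].

(* theta = min_i (psi_i + b_i); the minimum of the empty family is +oo. *)
Definition trop_min (R : realType) (T : Type) (n : nat)
    (psi : 'I_n -> T -> R) (b : 'I_n -> R) (v : T) : \bar R :=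
  \big[Order.min/+oo%E]_(i < n) (psi i v + b i)%:E.

Definition achieves_min (R : realType) (T : Type) (n : nat)
    (psi : 'I_n -> T -> R) (b : 'I_n -> R) (i : 'I_n) (v : T) : Prop :=
  trop_min psi b v = (psi i v + b i)%:E.

Definition achieves_min_uniquely (R : realType) (T : Type) (n : nat)
    (psi : 'I_n -> T -> R) (b : 'I_n -> R) (i : 'I_n) (v : T) : Prop :=
  achieves_min psi b i v /\ forall j, j != i -> ~ achieves_min psi b j v.

Definition tropically_dependent (R : realType) (T : Type) (n : nat)
    (psi : 'I_n -> T -> R) : Prop :=
  exists b : 'I_n -> R, forall v : T, exists i j : 'I_n,
    [/\ i != j, achieves_min psi b i v & achieves_min psi b j v].

Definition tropically_independent (R : realType) (T : Type) (n : nat)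
    (psi : 'I_n -> T -> R) : Prop :=
  ~ tropically_dependent psi.

(* Main.v *)
Require Import Defs.
From mathcomp Require Import all_boot all_order all_algebra.
From mathcomp Require Import all_classical all_reals all_analysis.
From mathcomp Require Import lra.
Set Implicit Arguments.
Unset Strict Implicit.
Unset Printing Implicit Defensive.
Import Order.TTheory GRing.Theory Num.Theory.
Import numFieldNormedType.Exports.
Local Open Scope classical_set_scope.
Local Open Scope ring_scope.

(* Put g_i(b) = sup_v min_{j <> i} (phi_j(v) + b_j - phi_i(v)), so that
   phi_i + b_i achieves the minimum uniquely somewhere iff b_i < g_i(b).
   Independence says that every b has some i with b_i < g_i(b), and one wants
   a b for which this holds for all i.  The map g is monotone and commutes with
   adding constants, and, phi being bounded on the compact graph, g_i(b) is at
   most b_j + M for j <> i.  For small e > 0 the discounted equation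
   u = g((1 - e) u) has a solution by Knaster-Tarski, and b = (1 - e) u
   satisfies g(b) - b = e u with u of oscillation at most 2 M.  If no such b has
   g(b) - b > 0 in all coordinates, then g(b) <= b + 2 M e for every e, and
   compactness gives a b with g(b) <= b, against independence.  Conversely, if
   b has the property and c is arbitrary, then the i minimizing c_i - b_i
   achieves the minimum uniquely for c at v_i. *)

(** * Sub- and supersolutions of monotone maps *)

Lemma tarski_fixpoint_box (R : realType) (I : Type) (lo hi : R)
    (F : (I -> R) -> I -> R) :
  lo <= hi ->
  (forall u w, (forall i, u i <= w i) -> forall i, F u i <= F w i) ->
  (forall u, (forall i, lo <= u i <= hi) -> forall i, lo <= F u i <= hi) ->
  exists2 u, forall i, lo <= u i <= hi & forall i, F u i = u i.
Proof.
move=> lohi Fmono Fbox.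
(* The largest fixed point is the pointwise supremum of the [w] in the box with [w <= F w]. *)
pose S : set (I -> R) :=
  [set w | (forall i, lo <= w i <= hi) /\ forall i, w i <= F w i].
pose u i : R := sup [set w i | w in S].
have Slo : S (fun=> lo).
  have bx : forall i : I, lo <= lo <= hi by move=> i; rewrite lexx.
  by split=> // i; case/andP: (Fbox _ bx i).
have Sne i : [set w i | w in S] !=set0 by exists lo, (fun=> lo).
have Sub w i : S w -> w i <= u i.
  move=> Sw; apply: ub_le_sup; last by exists w.
  by exists hi => _ [z [zb _] <-]; case/andP: (zb i).
have ubox i : lo <= u i <= hi.
  rewrite (Sub _ i Slo) /=; apply: ge_sup => // _ [w [wb _] <-].
  by case/andP: (wb i).
have uF i : u i <= F u i.
  apply: ge_sup => // _ [w Sw <-]; have [_ wF] := Sw.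
  by apply: le_trans (wF i) _; apply: Fmono => j; exact: Sub.
exists u => // i; apply/le_anti; rewrite uF andbT; apply: (Sub (F u)).
by split; [exact: Fbox|exact: Fmono].
Qed.

(** The discount makes the box of radius [M / e] invariant, because
    [(1 - e) * (M / e) + M = M / e]. *)
Lemma discounted_fixpoint (R : realType) (I : eqType) (M e : R)
    (g : (I -> R) -> I -> R) :
  (forall i : I, exists j, j != i) -> 0 <= M -> 0 < e <= 1 ->
  (forall b c, (forall i, b i <= c i) -> forall i, g b i <= g c i) ->
  (forall b i j, j != i -> g b i <= b j + M) ->
  (forall b c i, (forall j, c <= b j) -> c - M <= g b i) ->
  exists2 u, forall i, `|u i| <= M / e &
    forall i, g (fun j => (1 - e) * u j) i = u i.
Proof.
move=> neq M0 /andP[e0 e1] gmono gub glb.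
have eK : e * (M / e) = M by rewrite mulrCA divff ?mulr1 // gt_eqF.
have K0 : 0 <= M / e by rewrite divr_ge0 // ltW.
have e1' : 0 <= 1 - e by lra.
have [|||u uK uE] := @tarski_fixpoint_box R I (- (M / e)) (M / e)
  (fun u => g (fun j => (1 - e) * u j)).
- lra.
- by move=> u w uw i; apply: gmono => j; rewrite ler_wpM2l.
- move=> u uK i; have [j ji] := neq i; apply/andP; split.
    have -> : - (M / e) = (1 - e) * - (M / e) - M by lra.
    by apply: glb => k; rewrite ler_wpM2l //; case/andP: (uK k).
  apply: le_trans (gub _ _ _ ji) _.
  have := ler_wpM2l e1' (proj2 (andP (uK j))); lra.
by exists u => // i; rewrite ler_norml.
Qed.

Lemma approx_supersolution (R : realType) (I : eqType) (M e : R)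
    (g : (I -> R) -> I -> R) (o : I) :
  (forall i : I, exists j, j != i) -> 0 <= M -> 0 < e <= 1 ->
  (forall b c, (forall i, b i <= c i) -> forall i, g b i <= g c i) ->
  (forall b c i, g (fun j => b j + c) i <= g b i + c) ->
  (forall b i j, j != i -> g b i <= b j + M) ->
  (forall b c i, (forall j, c <= b j) -> c - M <= g b i) ->
  ~ (exists b, forall i, b i < g b i) ->
  exists2 b, forall i, `|b i| <= 2 * M & forall i, g b i <= b i + e * (2 * M).
Proof.
move=> neq M0 e01 gmono ghom gub glb nsub.
have [u uM uE] := discounted_fixpoint neq M0 e01 gmono gub glb.
have /andP[e0 e1] := e01; have e1' : 0 <= 1 - e by lra.
have euM i : `|e * u i| <= M.
  by rewrite normrM gtr0_norm // mulrC -ler_pdivlMr.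
(* For [j != i], [gub] gives [u i <= (1 - e) * u j + M], and [- e * u j] costs at most another
   [M]. *)
have du i j : u i <= u j + 2 * M.
  have [->|ji] := eqVneq j i; first lra.
  rewrite -[u i]uE; apply: le_trans (gub _ _ _ ji) _.
  have := euM j; rewrite ler_norml => /andP[]; lra.
(* If [u] were positive everywhere, [(1 - e) * u] would lie strictly below its image [u], against
   [nsub]. *)
have [i0 ui0] : exists i, u i <= 0.
  apply: contrapT => nu; apply: nsub; exists (fun j => (1 - e) * u j) => i.
  have ui : 0 < u i by rewrite ltNge; apply/negP => ?; apply: nu; exists i.
  by rewrite uE; have := mulr_gt0 e0 ui; lra.
(* Subtracting the value at [o] gives a bound independent of [e]; [u] itself is only known to be
   bounded by [M / e]. *)
exists (fun j => (1 - e) * u j - (1 - e) * u o) => i.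
  rewrite -mulrBr normrM ger0_norm //.
  have du' : `|u i - u o| <= 2 * M.
    by rewrite ler_norml; have := du i o; have := du o i; lra.
  by apply: le_trans (ler_piMl (normr_ge0 _) _) du'; lra.
apply: le_trans (ghom _ _ _) _; rewrite uE.
have := ler_wpM2l (ltW e0) (_ : u i <= 2 * M).
have := du i i0; lra.
Qed.

(** Monotonicity and [ghom] make [g] nonexpansive for the sup norm, so the approximate inequalities
    pass to a cluster point of approximate solutions in the compact cube. *)
Lemma supersolution_of_approx (R : realType) (I : finType) (K : R)
    (g : (I -> R) -> I -> R) :
  (forall b c, (forall i, b i <= c i) -> forall i, g b i <= g c i) ->
  (forall b c i, g (fun j => b j + c) i <= g b i + c) ->
  (forall e : R, 0 < e -> exists2 b, forall i, `|b i| <= K &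
     forall i, g b i <= b i + e) ->
  exists b, forall i, g b i <= b i.
Proof.
move=> gmono ghom approx.
have /choice[b_ b_P] (k : nat) : exists b, (forall i, `|b i| <= K) /\
    forall i, g b i <= b i + k.+1%:R^-1.
  by have [|b bK bg] := approx k.+1%:R^-1; [rewrite invr_gt0 ltr0n|exists b].
have cptB : compact [set b : prod_topology (fun _ : I => R) |
    forall i, [set` `[- K, K]] (b i)].
  apply: (@tychonoff I (fun=> R) (fun=> [set` `[- K, K]])) => i.
  exact: segment_compact.
have [|p [_ p_cluster]] := cptB (b_ @ \oo) _.
  by exists 0%N => // k _ i /=; rewrite in_itv /= -ler_norml; case: (b_P k).
exists p => i; apply/ler_addgt0Pr => e e0.
(* One third each for replacing [p] by a nearby [b] inside [g], for the defect of [b], and for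
   returning from [b i] to [p i]. *)
have e30 : 0 < e / 3 by rewrite divr_gt0.
have gb_near : \forall k \near \oo, forall j, g (b_ k) j <= b_ k j + e / 3.
  near=> k => j; have [_ /(_ j) bg] := b_P k.
  apply: le_trans bg _; rewrite lerD2l ltW //.
  by near: k; exact: (near_infty_natSinv_lt (PosNum e30)).
have [|b [gb bp]] := p_cluster
    [set b | forall i, g b i <= b i + e / 3]
    [set b | forall i, `|p i - b i| < e / 3] gb_near.
  (* As [I] is finite, this sup-norm ball is a neighbourhood of [p] in the product topology. *)
  apply: (@filter_forall _ I (fun i b => `|p i - b i| < e / 3) (nbhs p)) => j.
  exact: (@proj_continuous I (fun=> R) j p _ (nbhsx_ballx (p j) (e / 3) e30)).
have pb j : p j <= b j + e / 3.
  by have := bp j; rewrite ltr_norml => /andP[]; lra.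
apply: le_trans (gmono _ _ pb i) _; apply: le_trans (ghom _ _ _) _.
have := gb i; have := bp i; rewrite ltr_norml => /andP[]; lra.
Unshelve. all: by end_near. Qed.

Lemma subsolution_or_supersolution (R : realType) (I : finType) (M : R)
    (g : (I -> R) -> I -> R) :
  (forall i : I, exists j, j != i) -> 0 <= M ->
  (forall b c, (forall i, b i <= c i) -> forall i, g b i <= g c i) ->
  (forall b c i, g (fun j => b j + c) i <= g b i + c) ->
  (forall b i j, j != i -> g b i <= b j + M) ->
  (forall b c i, (forall j, c <= b j) -> c - M <= g b i) ->
  (exists b, forall i, b i < g b i) \/ (exists b, forall i, g b i <= b i).
Proof.
move=> neq M0 gmono ghom gub glb.
have [[i0 _]|noI] := pselect (exists o : I, True); last first.
  by right; exists (fun=> 0) => i; case: noI; exists i.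
have [|nsub] := pselect (exists b, forall i, b i < g b i); first by left.
right.
apply: (@supersolution_of_approx _ _ (2 * M)) => // e e0.
(* Chosen so that [d * (2 * M) <= e]; the added 1 keeps the denominator positive when [M = 0]. *)
pose d := Num.min 1 (e / (2 * M + 1)).
have M1 : 0 < 2 * M + 1 by lra.
have d01 : 0 < d <= 1.
  by rewrite ge_min lexx lt_min ltr01 divr_gt0.
have [b bM bg] := approx_supersolution i0 neq M0 d01 gmono ghom gub glb nsub.
exists b => // i; apply: le_trans (bg i) _; rewrite lerD2l.
have /andP[d0 _] := d01.
have : d * (2 * M + 1) <= e by rewrite -ler_pdivlMr // ge_min lexx orbT.
lra.
Qed.

(** * Unique minima and thresholds for finite families of bounded functions *)

Lemma achieves_minE (R : realType) (T : Type) (n : nat)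
    (psi : 'I_n -> T -> R) (b : 'I_n -> R) (i : 'I_n) (v : T) :
  achieves_min psi b i v <-> forall j, psi i v + b i <= psi j v + b j.
Proof.
rewrite /achieves_min /trop_min; split=> [minE j|le_i].
  by rewrite -lee_fin -minE; exact: bigmin_le.
apply/le_anti; rewrite bigmin_le /=; apply: le_bigmin => [|j _].
  by rewrite leey.
by rewrite lee_fin.
Qed.

Lemma achieves_min_exists (R : realType) (T : Type) (n : nat)
    (psi : 'I_n -> T -> R) (b : 'I_n -> R) (v : T) :
  'I_n -> exists i, achieves_min psi b i v.
Proof.
move=> i0; have [i _ le_i] := @Order.TotalTheory.arg_minP _ R 'I_n i0 predT
  (fun i => psi i v + b i) isT.
by exists i; apply/achieves_minE => j; exact: le_i.
Qed.

Lemma achieves_min_uniquelyE (R : realType) (T : Type) (n : nat)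
    (psi : 'I_n -> T -> R) (b : 'I_n -> R) (i : 'I_n) (v : T) :
  achieves_min_uniquely psi b i v <->
  forall j, j != i -> psi i v + b i < psi j v + b j.
Proof.
split=> [[/achieves_minE le_i uniq_i] j ji|lt_i].
  rewrite lt_neqAle le_i andbT; apply/eqP => ij.
  by apply: (uniq_i j ji); apply/achieves_minE => k; rewrite -ij.
split=> [|j ji].
  by apply/achieves_minE => j; have [->//|/lt_i/ltW] := eqVneq j i.
by move=> /achieves_minE/(_ i); rewrite leNgt lt_i.
Qed.

(** The index [i0] rules out the empty family, which is independent over a nonempty [T] but has no
    index to offer on the right. *)
Lemma tropically_independentP (R : realType) (T : Type) (n : nat)
    (psi : 'I_n -> T -> R) (i0 : 'I_n) :
  tropically_independent psi <->
  forall b, exists i v, achieves_min_uniquely psi b i v.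
Proof.
split=> [indep b|uniq [b dep]].
  apply: contrapT => nuniq; apply: indep; exists b => v.
  have [i min_i] := achieves_min_exists psi b v i0.
  apply: contrapT => ndep; apply: nuniq; exists i, v; split=> // j ji min_j.
  by apply: ndep; exists i, j; rewrite eq_sym ji.
have [i [v [_ uniq_i]]] := uniq b; have [j [k [jk min_j min_k]]] := dep v.
have [ji|ji] := eqVneq j i; last exact: uniq_i ji min_j.
by apply: uniq_i min_k; rewrite -ji eq_sym.
Qed.

Lemma tropically_independent_of_uniquely (R : realType) (T : Type) (n : nat)
    (psi : 'I_n -> T -> R) (i0 : 'I_n) (b : 'I_n -> R) :
  (forall i, exists v, achieves_min_uniquely psi b i v) ->
  tropically_independent psi.
Proof.
move=> uniq; apply/(tropically_independentP psi i0) => c.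
have [i _ le_i] := @Order.TotalTheory.arg_minP _ R 'I_n i0 predT
  (fun i => c i - b i) isT.
have [v /achieves_min_uniquelyE uniq_i] := uniq i.
exists i, v; apply/achieves_min_uniquelyE => j /uniq_i.
by have := le_i j isT; rewrite /=; lra.
Qed.

(** This is g_i of the overview, with the inner minimum unfolded into inequalities. For [n = 1] and
    nonempty [T] the set is all of [R] and [sup] takes its default 0, whence the hypothesis [neq]
    below. *)
Definition min_threshold (R : realType) (T : Type) (n : nat)
    (psi : 'I_n -> T -> R) (b : 'I_n -> R) (i : 'I_n) : R :=
  sup [set x | exists v, forall j, j != i -> psi i v + x <= psi j v + b j].

Section MinThreshold.
Context (R : realType) (T : Type) (n : nat) (psi : 'I_n -> T -> R).
Context (M : R) (v0 : T).
Context (neq : forall i : 'I_n, exists j, j != i).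
Context (psiM : forall i v, `|psi i v| <= M).

Let E b i :=
  [set x | exists v, forall j, j != i -> psi i v + x <= psi j v + b j].

Let psi_le i j v : psi i v <= psi j v + 2 * M.
Proof.
have := psiM i v; have := psiM j v.
by rewrite !ler_norml => /andP[? ?] /andP[? ?]; lra.
Qed.

Let E_ub b i j x : j != i -> E b i x -> x <= b j + 2 * M.
Proof. by move=> ji [v /(_ j ji)]; have := psi_le j i v; lra. Qed.

Let E_has_ubound b i : has_ubound (E b i).
Proof. by have [j ji] := neq i; exists (b j + 2 * M) => x; exact: E_ub. Qed.

Let E_lb b i c : (forall j, c <= b j) -> E b i (c - 2 * M).
Proof.
by move=> cb; exists v0 => j _; have := cb j; have := psi_le i j v0; lra.
Qed.

Let E_neq0 b i : E b i !=set0.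
Proof.
exists (\big[Num.min/b i]_j b j - 2 * M); apply: E_lb => j; exact: bigmin_le.
Qed.

Lemma min_threshold_mono b c : (forall i, b i <= c i) ->
  forall i, min_threshold psi b i <= min_threshold psi c i.
Proof.
move=> bc i; apply: ge_sup => [|x [v vP]]; first exact: E_neq0.
apply: ub_le_sup; first exact: E_has_ubound.
by exists v => j ji; apply: le_trans (vP j ji) _; rewrite lerD2l.
Qed.

Lemma min_threshold_shift b c i :
  min_threshold psi (fun j => b j + c) i <= min_threshold psi b i + c.
Proof.
apply: ge_sup => [|x [v vP]]; first exact: E_neq0.
rewrite -lerBlDr; apply: ub_le_sup; first exact: E_has_ubound.
by exists v => j /vP; lra.
Qed.

Lemma min_threshold_le b i j : j != i -> min_threshold psi b i <= b j + 2 * M.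
Proof. by move=> ji; apply: ge_sup => [|x]; [exact: E_neq0|exact: E_ub]. Qed.

Lemma min_threshold_ge b c i :
  (forall j, c <= b j) -> c - 2 * M <= min_threshold psi b i.
Proof. by move=> cb; apply: ub_le_sup; [exact: E_has_ubound|exact: E_lb]. Qed.

Lemma lt_min_threshold b i :
  b i < min_threshold psi b i <-> exists v, achieves_min_uniquely psi b i v.
Proof.
split=> [|[v /achieves_min_uniquelyE uniq_i]].
  move=> /sup_gt -/(_ (E_neq0 b i))[x [v vP] bx].
  exists v; apply/achieves_min_uniquelyE => j ji.
  by apply: lt_le_trans (vP j ji); rewrite ltrD2l.
(* The default [b i + 1] only has to exceed [b i], so that the strict inequalities at [v] yield
   [b i < x]. *)
pose x := \big[Num.min/b i + 1]_(j | j != i) (psi j v + b j - psi i v).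
apply: (@lt_le_trans _ _ x).
  by apply: lt_bigmin => [|j /uniq_i]; lra.
apply: ub_le_sup; first exact: E_has_ubound.
 exists v => j ji.
by rewrite addrC -lerBrDr; exact: bigmin_le_cond.
Qed.

End MinThreshold.

Lemma exists_all_achieve_uniquely (R : realType) (T : Type) (n : nat)
    (psi : 'I_n -> T -> R) (M : R) (v0 : T) :
  (forall i v, `|psi i v| <= M) -> tropically_independent psi ->
  exists b, forall i, exists v, achieves_min_uniquely psi b i v.
Proof.
move=> psiM indep.
have [[i0 _]|noI] := pselect (exists i : 'I_n, True); last first.
  by exists (fun=> 0) => i; case: noI; exists i.
have uniq := (tropically_independentP psi i0).1 indep.
have [neq|/existsNP[i /forallNP eqi]] :=
  pselect (forall i : 'I_n, exists j, j != i); last first.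
  (* Here [n = 1]: the single function is the unique minimizer at every point. *)
  exists (fun=> 0) => k; exists v0; apply/achieves_min_uniquelyE => j jk.
  have eq_i l : l = i by apply/eqP; apply: contra_notT (eqi l).
  by move: jk; rewrite (eq_i j) (eq_i k) eqxx.
have M0 : 0 <= 2 * M.
  by have := le_trans (normr_ge0 _) (psiM i0 v0); lra.
have ltP := lt_min_threshold v0 neq psiM.
have [[b bP]|[b bP]] := subsolution_or_supersolution neq M0
    (min_threshold_mono v0 neq psiM) (min_threshold_shift v0 neq psiM)
    (min_threshold_le v0 psiM) (min_threshold_ge v0 neq psiM).
  by exists b => i; apply/ltP.
have [i /ltP] := uniq b; by rewrite ltNge bP.
Qed.

(** * Compactness of the graph, and the theorem *)

Lemma edge_pt_interior (R : realType) (G : metric_graph R) (e : edge G) (t : R)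
    (te : 0 < t < len e) : edge_pt e t = Interior te.
Proof.
rewrite /edge_pt.
(* Eliminating [boolP] needs its boolean index generalized; [b = true] is carried along to refute
   the second branch. *)
refine (match boolP (0 < t < len e) as p in alt_spec _ _ b return b = true ->
  match p with
  | AltTrue h => Interior h
  | AltFalse _ => if t <= 0 then Vertex (src e) else Vertex (tgt e)
  end = Interior te with AltTrue h => _ | AltFalse _ => _ end te) => // _.
by congr Interior; exact: bool_irrelevance.
Qed.

(** The graph is the union of its finite vertex set and finitely many images of segments, under maps
    continuous by the choice of the quotient topology. *)
Lemma compact_graph (R : realType) (G : metric_graph R) :
  compact [set: graph_point G].
Proof.
have cont_edge e : continuous (@edge_pt R G e).
  by apply/continuousP => U; rewrite graph_openE; exact.
have -> : [set: graph_point G] =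
    range (@Vertex R G) `|`
    \big[setU/set0]_(e : edge G) (edge_pt e @` [set` `[0, len e]]).
  apply/esym/seteqP; split=> // -[w|e t te] _; first by left; exists w.
  right; rewrite -bigcup_seq; exists e => /=; first by rewrite mem_index_enum.
  exists t.
    by have /andP[t0 t1] := te; rewrite /= in_itv /= !ltW.
  exact: edge_pt_interior.
apply: compactU.
  by apply: finite_compact; apply: finite_image; exact: finite_finset.
apply: bigsetU_compact => e _; apply: continuous_compact.
  exact/continuous_subspaceT.
exact: segment_compact.
Qed.

Lemma PL_family_bounded (R : realType) (G : metric_graph R) (I : finType)
    (phi : I -> graph_point G -> R) :
  (forall i, PL (phi i)) -> exists M, forall i v, `|phi i v| <= M.
Proof.
move=> hphi.
have bnd i : exists M, forall v, `|phi i v| <= M.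
  have [phi_cont _] := hphi i.
  have : compact (range (phi i)).
    apply: continuous_compact; last exact: compact_graph.
    exact/continuous_subspaceT.
  move=> /compact_bounded/ex_strict_bound_gt0[M _ MP].
  by exists M => v; apply/ltW; apply: MP; exists v.
have /choice[M MP] := bnd.
exists (\big[Num.max/0]_i M i) => i v.
exact: le_trans (MP i v) (le_bigmax _ _ _).
Qed.

Theorem theorem1p6 (R : realType) (G : metric_graph R) (hG : connected_graph G)
    (n : nat) (phi : 'I_n -> graph_point G -> R) (hphi : forall i, PL (phi i)) :
  tropically_independent phi <->
  exists b : 'I_n -> R, forall i : 'I_n, exists v : graph_point G,
    achieves_min_uniquely phi b i v.
Proof.
have [[v0 _] _] := hG; split=> [indep|[b uniq]].
  have [M phiM] := PL_family_bounded hphi.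
  exact: exists_all_achieve_uniquely v0 phiM indep.
have [[i0 _]|noI] := pselect (exists i : 'I_n, True).
  exact: (tropically_independent_of_uniquely i0 uniq).
(* For [n = 0], dependence would provide an index at the point [v0]. *)
by move=> [c /(_ v0)[i _]]; apply: noI; exists i.
Qed.
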